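(* Let $H$ be a complex Hilbert space and let $A:\mathcal{D}(A)\subset H\to H$ be a closed, densely defined linear operator with $0\in\varrho(A)$. Suppose that $(P_n,A_n)_{n\in\mathbb{N}}$ approximates $A$ strongly. Let the shifts $s_1,\dots,s_m\in\varrho(A)$ be such that $$\sup_{n\in\mathbb{N}}\|(A_n-s_j)^{-1}\|<\infty\quad\text{for all } j=1,\dots,m$$ (in particular $s_j\in\varrho(A_n)$ for all $n$). Let $$0<\varepsilon<\frac{1}{\max_{j=1,\dots,m}\|(A-s_j)^{-1}\|}\quad\text{and}\quad \delta_j>\frac{\|(A-s_j)^{-1}\|^2\varepsilon}{1-\|(A-s_j)^{-1}\|\varepsilon}\quad\text{for all } j.$$ Then there exists $n_0\in\mathbb{N}$ such that $$\sigma_\varepsilon(A)\subset\bigcap_{j=1}^m\left[\left(B_{\delta_j}(W((A_n-s_j)^{-1}))\right)^{-1}+s_j\right]\quad\text{for all } n\ge n_0.$$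
   Context: $\varrho(A)$ is the resolvent set and $\sigma(A)=\mathbb{C}\setminus\varrho(A)$ the spectrum; $\mathcal{L}(X)$ denotes the bounded linear operators on $X$. The family $(P_n,A_n)_{n\in\mathbb{N}}$ approximates $A$ strongly if: (i) $U_n\subset H$, $n\in\mathbb{N}$, are finite-dimensional subspaces; (ii) $P_n\in\mathcal{L}(H)$ are projections (not necessarily orthogonal) with range $U_n$ and $\lim_{n\to\infty}P_nx=x$ for all $x\in H$; (iii) $A_n\in\mathcal{L}(U_n)$ are invertible and $\lim_{n\to\infty}A_n^{-1}P_nx=A^{-1}x$ for all $x\in H$. Here $U_n$ carries the norm and inner product of $H$, and norms and numerical ranges of operators on $U_n$ are taken with respect to these. The $\varepsilon$-pseudospectrum is $\sigma_\varepsilon(A)=\sigma(A)\cup\{\lambda\in\varrho(A): \|(A-\lambda)^{-1}\|>\frac1\varepsilon\}$. The numerical range of an operator $T$ is $W(T)=\{\langle Tx,x\rangle: x\in\mathcal{D}(T),\ \|x\|=1\}$. For $U\subset\mathbb{C}$ and $\delta>0$: $B_\delta(U)=\{z\in\mathbb{C}:\operatorname{dist}(z,U)<\delta\}$, $U^{-1}=\{z^{-1}: z\in U\setminus\{0\}\}$, $U+s=\{z+s: z\in U\}$. *)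

(* Defs.v *)
From HB Require Import structures.
From mathcomp Require Export all_boot all_order all_algebra sesquilinear.
From mathcomp Require Export complex.
From mathcomp Require Export all_classical all_reals all_analysis.

Set Implicit Arguments.
Unset Strict Implicit.
Unset Printing Implicit Defensive.

Export Order.TTheory GRing.Theory Num.Theory.
Export numFieldNormedType.Exports.

Local Open Scope classical_set_scope.
Local Open Scope ring_scope.

(* A possibly unbounded operator with its domain; the values of [app] outside
   [dom] are irrelevant, and every notion below only looks at [app] on [dom].
   Linearity is the separate predicate [linear_operator]. *)
Record operator (V : Type) := Operator { dom : set V; app :> V -> V }.

Section Algebra.
Context {K : fieldType} {V : lmodType K}.
Implicit Type T : operator V.

Definition linear_operator T :=
  dom T 0 /\
  forall (a : K) (x y : V), dom T x -> dom T y ->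
    dom T (a *: x + y) /\ T (a *: x + y) = a *: T x + T y.

(* T - s *)
Definition subop T (s : K) : operator V :=
  Operator (dom T) (fun x => T x - s *: x).

(* T^-1, with domain the range of T; meaningful when T is injective on its
   domain. *)
Definition invop T : operator V :=
  Operator (T @` dom T) ('pinv_(fun=> 0) (dom T) T).

Definition finite_dim_subspace (U : set V) :=
  exists (k : nat) (b : 'I_k -> V),
    U = [set \sum_(i < k) c i *: b i | c in [set: 'I_k -> K]].

End Algebra.

Section Hilbert.
Context {R : realType} {H : completeNormedModType R[i]}.
Implicit Types (T : operator H) (V : set H).

(* The library norm of H takes its (real) values in R[i]. *)
Definition rnorm (x : H) : R := complex.Re `|x|.

(* Operator norm over the domain of T, +oo when T is unbounded. *)
Definition opnorm T : \bar R :=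
  ereal_sup [set (rnorm (T x))%:E | x in [set x | dom T x /\ rnorm x <= 1]].

Definition closed_operator T :=
  closed [set p : H * H | dom T p.1 /\ p.2 = T p.1].

Definition bounded_endo V T :=
  [/\ linear_operator T, dom T = V, {homo T : x / V x} & (opnorm T < +oo)%E].

(* In the following definitions the operator T acts in the subspace V of H
   (dom T is contained in V and T maps into V): V = setT for A and V = U_n for
   A_n. *)
Definition resolvent_set V T : set R[i] :=
  [set l | set_bij (dom T) V (subop T l) /\
           (opnorm (invop (subop T l)) < +oo)%E].

Definition spectrum V T : set R[i] := ~` resolvent_set V T.

Definition pseudospectrum V T (eps : R) : set R[i] :=
  spectrum V T `|`
  [set l | resolvent_set V T l /\
           ((eps^-1)%:E < opnorm (invop (subop T l)))%E].

Definition numerical_range (dot : H -> H -> R[i]) T : set R[i] :=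
  [set dot (T x) x | x in [set x | dom T x /\ rnorm x = 1]].

Definition approximates_strongly (U : nat -> set H) (P : nat -> {linear H -> H})
    (An : nat -> operator H) (A : operator H) :=
  [/\ forall n, finite_dim_subspace (U n),
      forall n, [/\ continuous (P n), forall x, P n (P n x) = P n x
                  & range (P n) = U n],
      forall x, P n x @[n --> \oo] --> x,
      forall n, bounded_endo (U n) (An n) /\ set_bij (U n) (U n) (An n)
    & forall x, invop (An n) (P n x) @[n --> \oo] --> invop A x].

End Hilbert.

Section ComplexSets.
Context {R : realType}.
Implicit Type U : set R[i].

(* dist(z, U), equal to +oo when U is empty *)
Definition cdist (z : R[i]) U : \bar R :=
  ereal_inf [set (complex.Re `|z - u|)%:E | u in U].

(* B_d(U) *)
Definition thickening (d : R) U : set R[i] := [set z | (cdist z U < d%:E)%E].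

Definition inv_set U : set R[i] := [set z^-1 | z in U `\ 0].

Definition shift_set U (s : R[i]) : set R[i] := [set z + s | z in U].

End ComplexSets.

(* Main.v *)
(* Let B = (A - s)^-1, N = |B| and z = (l - s)^-1 for l in the
   eps-pseudospectrum.  If A - l has a unit vector x with |(A - l)x| < eps,
   then z - <Bx,x> = z <B(A - l)x, x> has modulus at most N^2 eps / (1 - N eps).
   Otherwise A - l is bounded below by eps, so its range is closed, and it is a
   proper subspace, since l is in the pseudospectrum; a unit vector v almost
   orthogonal to that range (Riesz' lemma) makes z - <Bv,v> = z <(A - l)Bv, v>
   arbitrarily small.  So z is close to W(B), uniformly in l.  The resolvents
   (A_n - s)^-1 P_n converge strongly to B, which approximates each point of
   W(B) by points of W((A_n - s)^-1), and this is uniform because W(B) is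
   totally bounded. *)
Require Import Defs.
From mathcomp Require Import lra ring.

Set Implicit Arguments.
Unset Strict Implicit.
Unset Printing Implicit Defensive.

Local Open Scope classical_set_scope.
Local Open Scope ring_scope.
Local Open Scope complex_scope.
Import Normc.

(** * Real-valued norm and complex modulus *)

Section Rnorm.
Context {R : realType} {H : completeNormedModType R[i]}.
Implicit Types (x y : H) (a : R[i]).

Lemma rnormE x : `|x| = (rnorm x)%:C.
Proof. by rewrite RRe_real// ger0_real. Qed.

Lemma rnorm_ge0 x : 0 <= rnorm x.
Proof. by rewrite -ler0c -rnormE. Qed.

Lemma rnorm0 : rnorm (0 : H) = 0.
Proof. by apply: complexI; rewrite -rnormE normr0. Qed.

Lemma rnorm_eq0 x : rnorm x = 0 -> x = 0.
Proof. by move=> x0; apply/normr0_eq0; rewrite rnormE x0. Qed.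

Lemma rnormN x : rnorm (- x) = rnorm x.
Proof. by rewrite /rnorm normrN. Qed.

Lemma rnorm_distC x y : rnorm (x - y) = rnorm (y - x).
Proof. by rewrite -rnormN opprB. Qed.

Lemma rnormD x y : rnorm (x + y) <= rnorm x + rnorm y.
Proof. by rewrite -lecR rmorphD/= -!rnormE ler_normD. Qed.

Lemma rnormZ a x : rnorm (a *: x) = normc a * rnorm x.
Proof. by apply: complexI; rewrite rmorphM/= -!rnormE normrZ. Qed.

Lemma rnormZr (a : R) x : 0 <= a -> rnorm (a%:C *: x) = a * rnorm x.
Proof. by move=> a0; rewrite rnormZ /= expr0n/= addr0 sqrtr_sqr ger0_norm. Qed.

Lemma rnorm_normalized x : x != 0 -> rnorm ((rnorm x)^-1%:C *: x) = 1.
Proof.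
move=> x0; rewrite rnormZr ?invr_ge0 ?rnorm_ge0// mulVf//.
by apply: contra x0 => /eqP/rnorm_eq0->.
Qed.

Lemma cvg_rnorm_dist (u : nat -> H) (l : H) :
  u @ \oo --> l -> (fun n => rnorm (u n - l)) @ \oo --> (0 : R).
Proof.
move=> ul; apply/cvgr0Pnorm_lt => e e0.
have /cvgrPdist_lt/(_ e%:C) := ul; rewrite ltcR => /(_ e0).
apply: filterS => n; rewrite ger0_norm ?rnorm_ge0//.
by rewrite rnormE ltcR rnorm_distC.
Qed.

End Rnorm.

Lemma normc_ge0 (R : rcfType) (z : R[i]) : 0 <= normc z.
Proof. by case: z => a b; rewrite sqrtr_ge0. Qed.

Lemma normc_real (R : rcfType) (r : R) : 0 <= r -> normc r%:C = r.
Proof. by move=> r0; rewrite /= expr0n/= addr0 sqrtr_sqr ger0_norm. Qed.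

Lemma normc_le_ReIm (R : rcfType) (z : R[i]) :
  normc z <= `|complex.Re z| + `|complex.Im z|.
Proof.
rewrite {1}[z]complexE; apply: (le_trans (le_normcD _ _)); rewrite normcM.
case: z => a b /=.
by rewrite !expr0n/= !expr1n !addr0 !add0r !sqrtr_sqr sqrtr1 mul1r.
Qed.

Lemma Re_le_normc (R : rcfType) (z : R[i]) : `|complex.Re z| <= normc z.
Proof.
case: z => a b /=; rewrite -sqrtr_sqr; apply: ler_wsqrtr.
by rewrite lerDl sqr_ge0.
Qed.

Lemma Im_le_normc (R : rcfType) (z : R[i]) : `|complex.Im z| <= normc z.
Proof.
case: z => a b /=; rewrite -sqrtr_sqr; apply: ler_wsqrtr.
by rewrite lerDr sqr_ge0.
Qed.

(** * Inner product geometry: Cauchy-Schwarz and Riesz' lemma *)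

Section Dot.
Context {R : realType} {H : completeNormedModType R[i]}.
Variable dot : {dot H for Num.conj}.
Hypothesis dot_norm : forall x : H, dot x x = `|x| ^+ 2.

Lemma dotC x y : dot x y = Num.conj (dot y x).
Proof. by rewrite [LHS]hermC/= expr0 mul1r. Qed.

Lemma normc_dotC x y : normc (dot x y) = normc (dot y x).
Proof.
apply: complexI; rewrite dotC.
by transitivity `|Num.conj (dot y x)|; [|rewrite norm_conjC].
Qed.

Lemma dotBl x y z : dot (x - y) z = dot x z - dot y z.
Proof. exact: linearBl. Qed.

Lemma dotZl a x y : dot (a *: x) y = a * dot x y.
Proof. exact: linearZl_LR. Qed.

Lemma dotZr a x y : dot x (a *: y) = Num.conj a * dot x y.
Proof. by rewrite linearZr_LR. Qed.

Lemma dot_unit x : rnorm x = 1 -> dot x x = 1.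
Proof. by move=> x1; rewrite dot_norm rnormE x1 expr1n. Qed.

(* [D = 0] is the Cauchy-Schwarz inequality; for [D > 0] it measures how far
   from orthogonal to a subspace a near-minimiser of the distance to it is. *)
Lemma dot_sqr_le (v m : H) (D : R) : 0 <= D ->
  (forall t : R[i], D <= rnorm (v - t *: m)) ->
  normc (dot v m) ^+ 2 <= (rnorm v ^+ 2 - D ^+ 2) * rnorm m ^+ 2.
Proof.
move=> D0 Dle; have [->|m0] := eqVneq m 0.
  by rewrite linear0r normc0 rnorm0 !expr0n/= mulr0.
have mn0 : rnorm m != 0 by apply: contra m0 => /eqP/rnorm_eq0->.
(* [t *: m] is the orthogonal projection of [v] onto the line through [m], so this [t] minimises the
   distance and gives the sharpest instance of the hypothesis. *)
pose t := dot v m / `|m| ^+ 2.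
have : D ^+ 2 <= rnorm (v - t *: m) ^+ 2 by rewrite ler_sqr ?nnegrE ?rnorm_ge0.
suff -> : rnorm (v - t *: m) ^+ 2
    = rnorm v ^+ 2 - normc (dot v m) ^+ 2 / rnorm m ^+ 2.
  have m2 : 0 < rnorm m ^+ 2 by rewrite exprn_even_gt0.
  by rewrite -ler_pdivrMr// => h; lra.
apply: complexI; rewrite rmorphB fmorph_div !rmorphXn/=.
rewrite -!rnormE -dot_norm.
have -> : (normc (dot v m))%:C = `|dot v m| by [].
have nm0 : `|m| != 0 by rewrite normr_eq0.
rewrite normCK linearBl/= !linearBr/= !dotZl !dotZr [dot m v]dotC !dot_norm.
have -> : Num.conj t = Num.conj (dot v m) / `|m| ^+ 2.
  by rewrite /t fmorph_div rmorphXn/= [Num.conj `|m|]conj_Creal ?normr_real.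
by rewrite /t; field.
Qed.

Lemma dot_le (v m : H) : normc (dot v m) <= rnorm v * rnorm m.
Proof.
rewrite -ler_sqr ?nnegrE ?mulr_ge0 ?normc_ge0 ?rnorm_ge0// exprMn.
have := @dot_sqr_le v m 0 (lexx _) (fun t => rnorm_ge0 _).
by rewrite expr0n/= subr0.
Qed.

(** The vector [v] is the normalised residual [y - m0] of a near-minimiser [m0] of the distance [D]
    from [y] to [M]. Shifting [m0] along any [u] in [M] keeps the distance at least [D], so
    [dot_sqr_le] applies to the residual. *)
Lemma almost_orthogonal (M : set H) (y : H) (d e : R) :
  M 0 -> (forall a u v, M u -> M v -> M (a *: u + v)) ->
  0 < d -> (forall u, M u -> d <= rnorm (y - u)) -> 0 < e ->
  exists2 v, rnorm v = 1 & forall u, M u -> normc (dot u v) <= e * rnorm u.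
Proof.
move=> M0 Mlin d0 dle e0.
pose S := [set rnorm (y - u) | u in M].
have Sinf : has_inf S.
  split; first by exists (rnorm (y - 0)), 0.
  by exists d => _ [u /dle ? <-].
have Dle u : M u -> inf S <= rnorm (y - u).
  by move=> Mu; apply: inf_lbound; [case: Sinf|exists u].
have D0 : 0 < inf S.
  apply: (lt_le_trans d0).
  by apply: lb_le_inf; [case: Sinf|move=> _ [u /dle ? <-]].
set D := inf S in Dle D0 *.
(* With this [k], [r < D * k] gives [r ^+ 2 - D ^+ 2 <= (e * D) ^+ 2 <= (e * r) ^+ 2], which is the
   factor in [dot_sqr_le] before dividing by [r]. *)
pose k := Num.sqrt (1 + e ^+ 2).
have k2 : k ^+ 2 = 1 + e ^+ 2 by rewrite sqr_sqrtr// addr_ge0// sqr_ge0.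
have k1 : 1 < k.
  by rewrite -sqrtr1 ltr_sqrt ?ltrDl ?exprn_gt0// ltr_wpDr// exprn_ge0// ltW.
have kD : 0 < D * (k - 1) by rewrite mulr_gt0// subr_gt0.
have [_ [m0 Mm0 <-] m0lt] := inf_adherent kD Sinf.
rewrite -/D in m0lt.
pose r := rnorm (y - m0).
have rlt : r < D * k by move: m0lt; rewrite -/r; lra.
have Dr : D <= r by exact: Dle.
have r0 : 0 < r by exact: lt_le_trans Dr.
have ym0 : y - m0 != 0.
  by apply/eqP => h; move: r0; rewrite /r h rnorm0 ltxx.
exists (r^-1%:C *: (y - m0)); first exact: rnorm_normalized.
move=> u Mu; rewrite normc_dotC.
rewrite dotZl normcM normc_real ?invr_ge0 ?(ltW r0)//.
rewrite mulrC ler_pdivrMr//.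
rewrite -ler_sqr ?nnegrE ?mulr_ge0 ?normc_ge0 ?rnorm_ge0 ?(ltW r0) ?(ltW e0)//.
have Dt (t : R[i]) : D <= rnorm (y - m0 - t *: u).
  rewrite -addrA -opprD; apply: Dle; rewrite addrC; exact: Mlin.
apply: (le_trans (dot_sqr_le (ltW D0) Dt)).
rewrite -/r mulrAC exprMn ler_wpM2r ?sqr_ge0//.
have : r ^+ 2 <= (D * k) ^+ 2.
  by rewrite ler_sqr ?nnegrE ?(ltW r0) ?mulr_ge0 ?(ltW D0) ?sqrtr_ge0// ltW.
rewrite !exprMn k2 => h.
have : (e * D) ^+ 2 <= (e * r) ^+ 2.
  rewrite ler_sqr ?nnegrE ?mulr_ge0 ?(ltW r0) ?(ltW D0) ?(ltW e0)//.
  by rewrite ler_wpM2l// ltW.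
by rewrite !exprMn; lra.
Qed.

End Dot.

(** * Unbounded operators: linearity, operator norm, inverses, closed range *)

Section Operators.
Context {R : realType} {H : completeNormedModType R[i]}.
Implicit Types (T : operator H) (V : set H).

Lemma linopB T x y : linear_operator T -> dom T x -> dom T y ->
  dom T (x - y) /\ T (x - y) = T x - T y.
Proof.
move=> [_ Tl] xT yT; have [] := Tl (-1) _ _ yT xT.
by rewrite !scaleN1r [- y + _]addrC [- T y + _]addrC.
Qed.

Lemma linopZ T (a : R[i]) x : linear_operator T -> dom T x ->
  dom T (a *: x) /\ T (a *: x) = a *: T x.
Proof.
move=> [T0 Tl] xT.
have [_ T00] := Tl 1 _ _ T0 T0.
have {}T00 : T 0 = 0.
  by apply: (@addIr _ (T 0)); rewrite add0r -{1}[T 0]scale1r -T00 scaler0 addr0.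
by have [] := Tl a _ _ xT T0; rewrite T00 !addr0.
Qed.

Lemma linop0 T : linear_operator T -> T 0 = 0.
Proof.
by move=> Tl; have [_] := linopZ 0 Tl (proj1 Tl); rewrite !scale0r.
Qed.

Lemma subop_linear T (l : R[i]) :
  linear_operator T -> linear_operator (subop T l).
Proof.
move=> [T0 Tl]; split=> // a x y xT yT /=; have [? ->] := Tl a _ _ xT yT.
split=> //; rewrite scalerDr opprD addrACA scalerBr; congr (_ - _ + _).
by rewrite !scalerA mulrC.
Qed.

Lemma opnorm_bound T : linear_operator T -> (opnorm T < +oo)%E ->
  exists N : R, [/\ opnorm T = N%:E, 0 <= N &
    forall x, dom T x -> rnorm (T x) <= N * rnorm x].
Proof.
move=> Tlin Tfin.
have ub x : dom T x -> rnorm x <= 1 -> ((rnorm (T x))%:E <= opnorm T)%E.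
  by move=> xT x1; apply: ereal_sup_ubound; exists x.
have op0 : (0 <= opnorm T)%E.
  by have := ub 0 (proj1 Tlin); rewrite rnorm0 linop0// rnorm0; apply.
have fin : opnorm T \is a fin_num by rewrite ge0_fin_numE.
exists (fine (opnorm T)); rewrite fineK//; split=> // [|x xT].
  exact: fine_ge0.
have [->|x0] := eqVneq x 0; first by rewrite linop0// !rnorm0 mulr0.
have xn : 0 < rnorm x.
  by rewrite lt_def rnorm_ge0 andbT; apply: contra x0 => /eqP/rnorm_eq0->.
have [xT' Tx] := linopZ (rnorm x)^-1%:C Tlin xT.
have := ub _ xT'; rewrite rnorm_normalized// Tx rnormZr ?invr_ge0 ?(ltW xn)//.
by rewrite -(fineK fin) => /(_ (lexx _)); rewrite lee_fin mulrC ler_pdivrMr.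
Qed.

Lemma opnorm_le T (c : R) : 0 <= c ->
  (forall x, dom T x -> rnorm (T x) <= c * rnorm x) -> (opnorm T <= c%:E)%E.
Proof.
move=> c0 Tc; apply: ub_ereal_sup => _ [x [xT x1] <-].
by rewrite lee_fin; apply: (le_trans (Tc _ xT)); rewrite ler_piMr.
Qed.

(** Everything later known about [invop] goes through these three facts; bijectivity turns the
    partial inverse [pinv] into a genuine two-sided one. *)
Lemma invopP V T : set_bij (dom T) V T ->
  [/\ dom (invop T) = V,
      forall y, V y -> dom T (invop T y) /\ T (invop T y) = y &
      forall x, dom T x -> invop T (T x) = x].
Proof.
move=> Tbij; have [Thom Tinj Tsurj] := Tbij.
have TV : T @` dom T = V by apply/seteqP; split=> // _ [x xT <-]; exact: Thom.
split=> [//|y Vy|x xT] /=.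
- have yV : y \in T @` dom T by rewrite inE TV.
  split; last exact: pinvK.
  exact: (surjpinv_image_sub Tsurj (imageP _ Vy)).
- by apply: pinvKV => //; rewrite inE.
Qed.

Lemma invop_linear V T : linear_operator T -> set_bij (dom T) V T ->
  linear_operator (invop T).
Proof.
move=> Tlin Tbij; have [Vd VK KV] := invopP Tbij.
have [Thom _ _] := Tbij.
have T0V : V 0 by rewrite -(linop0 Tlin); apply: Thom; exact: (proj1 Tlin).
split; first by rewrite Vd.
rewrite Vd => a x y /VK[xd xE] /VK[yd yE].
have [sd sE] := (proj2 Tlin) a _ _ xd yd.
rewrite xE yE in sE.
split; first by rewrite -sE; exact: Thom.
by rewrite -{1}sE KV.
Qed.

Lemma resolventP V T (l : R[i]) : linear_operator T -> resolvent_set V T l ->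
  let B := invop (subop T l) in
  [/\ linear_operator B /\ dom B = V,
      forall y, V y -> dom T (B y) /\ T (B y) - l *: B y = y,
      forall x, dom T x -> V (T x - l *: x) /\ B (T x - l *: x) = x &
      exists N : R, [/\ opnorm B = N%:E, 0 <= N &
        forall y, V y -> rnorm (B y) <= N * rnorm y]].
Proof.
move=> Tlin [bij fin] B; have Slin := subop_linear l Tlin.
have [Bd BK KB] := @invopP V (subop T l) bij; have [Shom _ _] := bij.
have Blin := @invop_linear V (subop T l) Slin bij.
split=> //.
- by move=> x xT; split; [exact: Shom|exact: KB].
- have [N [NE N0 Nle]] := opnorm_bound Blin fin.
  by exists N; split=> // y Vy; apply: Nle; rewrite Bd.
Qed.

(** The lower bound makes preimages of a convergent sequence Cauchy. They converge by completeness
    of [H], and the closed graph shows that their limit is sent to [y]. *)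
Lemma bounded_below_range_closed T (l : R[i]) (c : R) (y : H) :
  linear_operator T -> closed_operator T -> 0 < c ->
  (forall x, dom T x -> c * rnorm x <= rnorm (T x - l *: x)) ->
  (forall e : R, 0 < e -> exists2 x, dom T x & rnorm (y - (T x - l *: x)) < e) ->
  exists2 x, dom T x & T x - l *: x = y.
Proof.
move=> Tlin Tcl c0 Tc yT.
have /boolp.choice[x xP] : forall n : nat, exists x,
    dom T x /\ rnorm (y - (T x - l *: x)) < n.+1%:R^-1.
  by move=> n; have [|x ? ?] := yT n.+1%:R^-1; [rewrite invr_gt0|exists x].
pose z n := T (x n) - l *: x n.
have zy : z @ \oo --> y.
  apply/cvgrPdist_lt => e e0.
  have er : e = (complex.Re e)%:C by rewrite RRe_real// gtr0_real.
  rewrite er ltcR in e0; rewrite er.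
  have := near_infty_natSinv_lt (PosNum e0).
  apply: filterS => n /= ne; rewrite rnormE ltcR.
  by apply: lt_trans ne; case: (xP n).
(* The lower bound is applied to [x k - x n], whose image is the difference of two residuals of size
   at most [k.+1%:R^-1] and [n.+1%:R^-1]. *)
have xdist k n : c * rnorm (x k - x n) <= k.+1%:R^-1 + n.+1%:R^-1.
  have [xk zk] := xP k; have [xn zn] := xP n.
  have [xB TB] := linopB Tlin xk xn.
  apply: (le_trans (Tc _ xB)).
  have -> : T (x k - x n) - l *: (x k - x n) = (y - z n) - (y - z k).
    have -> a b : y - b - (y - a) = a - b by rewrite opprB addrC addrA subrK.
    by rewrite TB scalerBr /z opprD addrACA -opprD.
  by apply: (le_trans (rnormD _ _)); rewrite rnormN addrC lerD ?ltW.
have : cvgn x.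
  apply/cauchy_cvgP/cauchy_exP => e e0.
  have er : e = (complex.Re e)%:C by rewrite RRe_real// gtr0_real.
  have e'0 : 0 < complex.Re e by rewrite -ltcR -er.
  have ce0 : 0 < c * complex.Re e / 2 by rewrite divr_gt0 ?mulr_gt0.
  have [N _ Nle] := near_infty_natSinv_lt (PosNum ce0).
  exists (x N); change (\forall k \near \oo, ball (x N) e (x k)); near=> k.
  rewrite -ball_normE /= er rnormE ltcR -(ltr_pM2l c0).
  apply: (le_lt_trans (xdist _ _)).
  have NleE n : (N <= n)%N -> n.+1%:R^-1 < c * complex.Re e / 2 := Nle n.
  have Nk : (N <= k)%N by near: k; exists N.
  by rewrite [ltRHS]splitr ltrD// NleE.
move=> /cvg_ex[x0 xx0].
(* Closedness is a property of the graph of [T], not of [T - l], so the limit of [z n] is translated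
   back by [l *: x n]. *)
have Axy : (fun n => T (x n)) @ \oo --> y + l *: x0.
  rewrite (_ : (fun n => T (x n)) = (fun n => z n + l *: x n)).
    by apply: cvgD => //; apply: cvgZ => //; exact: cvg_cst.
  by apply/funext => n; rewrite /z subrK.
have [x0T Tx0] : [set p : H * H | dom T p.1 /\ p.2 = T p.1] (x0, y + l *: x0).
  have := @closed_cvg _ _ (\oo : set_system nat) _ (fun n => (x n, T (x n))) _ Tcl.
  apply.
    by near=> n; split=> //; case: (xP n).
  exact: cvg_pair.
by exists x0 => //; rewrite -Tx0 addrK.
Unshelve. all: by end_near. Qed.

End Operators.

(** * Pseudospectral points and the numerical range of the resolvent *)

Section NumericalRange.
Context {R : realType} {H : completeNormedModType R[i]}.
Variable dot : {dot H for Num.conj}.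
Hypothesis dot_norm : forall x : H, dot x x = `|x| ^+ 2.

Lemma pseudospectrum_near_numerical_range (A : operator H) (s l : R[i])
    (N eps eta : R) :
  linear_operator A -> closed_operator A -> resolvent_set setT A s ->
  opnorm (invop (subop A s)) = N%:E -> 0 < eps -> N * eps < 1 ->
  pseudospectrum setT A eps l -> 0 < eta ->
  l != s /\
  exists2 x, rnorm x = 1 & normc ((l - s)^-1 - dot (invop (subop A s) x) x)
    < N ^+ 2 * eps / (1 - N * eps) + eta.
Proof.
move=> Alin Acl sA NE e0 Ne1 lA eta0.
have [[Blin Bd] BK KB [N' [N'E N0 Nle]]] := resolventP Alin sA.
have {N'E} NN' : N' = N by move: N'E; rewrite NE => -[].
subst N'; set B := invop (subop A s) in Blin Bd BK KB Nle *.
(* The shift [s] is in the resolvent set and its resolvent has norm [N < eps^-1], so [s] is outside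
   the pseudospectrum. *)
have ls : l != s.
  apply/eqP => lE; subst s; case: lA => [|[_]]; first by [].
  rewrite NE lte_fin -[eps^-1]mul1r ltr_pdivrMr// => /lt_trans/(_ Ne1).
  by rewrite ltxx.
split=> //.
have ls0 : l - s != 0 by rewrite subr_eq0.
set z := (l - s)^-1.
have zls : z * (l - s) = 1 by rewrite mulVf.
have Ne0 : 0 < 1 - N * eps by rewrite subr_gt0.
have z0 := normc_ge0 z.
have [[x [xA xlt]]|nx] := pselect (exists x,
    dom A x /\ rnorm (A x - l *: x) < eps * rnorm x).
  have x0 : x != 0.
    apply/eqP => x0; move: xlt; rewrite x0 rnorm0 mulr0.
    by rewrite ltNge rnorm_ge0.
  have xn : 0 < rnorm x.
    by rewrite lt_def rnorm_ge0 andbT; apply: contra x0 => /eqP/rnorm_eq0->.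
  pose u := (rnorm x)^-1%:C *: x.
  have u1 : rnorm u = 1 by exact: rnorm_normalized.
  have [uA Au] := linopZ (rnorm x)^-1%:C Alin xA.
  rewrite -/u in uA Au.
  pose y := A u - l *: u.
  have ylt : rnorm y < eps.
    rewrite /y Au /u scalerA mulrC -scalerA -scalerBr rnormZr ?invr_ge0 ?(ltW xn)//.
    by rewrite mulrC ltr_pdivrMr.
  have [_ Bu] := KB _ uA.
  have uE : A u - s *: u = (l - s) *: u + y.
    by rewrite /y scalerBl [RHS]addrC addrA subrK.
  have yB : dom B y by rewrite Bd.
  have uB : dom B u by rewrite Bd.
  have [_ BE] := (proj2 Blin) (l - s) _ _ uB yB.
  (* Applying [B] to [uE] gives [u = (l - s) *: B u + B y], solved here for [B u]. *)
  have {}Bu : B u = z *: (u - B y).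
    by rewrite -[in RHS]Bu uE BE addrK scalerA zls scale1r.
  exists u => //.
  have -> : z - dot (B u) u = z * dot (B y) u.
    by rewrite Bu dotZl dotBl dot_unit//; ring.
  have By : rnorm (B y) <= N * eps.
    by apply: (le_trans (Nle _ I)); rewrite ler_wpM2l// ltW.
  (* From [B u = z *: (u - B y)]: the left side has norm at most [N], while [u - B y] has norm at
     least [1 - N * eps]. *)
  have zN : normc z <= N / (1 - N * eps).
    rewrite ler_pdivlMr//; apply: (@le_trans _ _ (rnorm (B u))).
      rewrite Bu rnormZ ler_wpM2l//.
      have := rnormD (u - B y) (B y); rewrite subrK u1; lra.
    by have := Nle u I; rewrite u1 mulr1.
  rewrite normcM.
  have d1 : normc (dot (B y) u) <= N * eps.
    by apply: (le_trans (dot_le dot_norm _ _)); rewrite u1 mulr1.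
  have : normc z * normc (dot (B y) u) <= N / (1 - N * eps) * (N * eps).
    by apply: ler_pM => //; exact: normc_ge0.
  have -> : N / (1 - N * eps) * (N * eps) = N ^+ 2 * eps / (1 - N * eps).
    by rewrite mulrAC mulrA -expr2.
  lra.
have lb x : dom A x -> eps * rnorm x <= rnorm (A x - l *: x).
  by move=> xA; rewrite leNgt; apply/negP => h; apply: nx; exists x.
pose M := [set A x - l *: x | x in dom A].
(* If [A - l] were onto, the lower bound would make it bijective with inverse of norm at most
   [eps^-1], contradicting the membership of [l] in the pseudospectrum. *)
have [MT|/existsNP[y My]] := pselect (forall y, M y).
  exfalso.
  have Slin := subop_linear l Alin.
  have bij : set_bij (dom A) setT (subop A l).
    split=> //; last by move=> y _; have := MT y.
    move=> x1 x2 /set_mem x1A /set_mem x2A /= xE.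
    have [x12 AB] := linopB Slin x1A x2A.
    have := lb _ x12; rewrite /= in AB; rewrite AB xE subrr rnorm0.
    rewrite pmulr_rle0// => h; apply/eqP; rewrite -subr_eq0; apply/eqP/rnorm_eq0.
    by apply/eqP; rewrite eq_le h rnorm_ge0.
  have [Cd CK _] := @invopP _ _ setT (subop A l) bij.
  have Cle : (opnorm (invop (subop A l)) <= eps^-1%:E)%E.
    apply: opnorm_le; first by rewrite invr_ge0 ltW.
    move=> w _; have [Cw CE] := CK w I.
    by rewrite mulrC ler_pdivlMr// mulrC -[in leRHS]CE; exact: lb.
  case: lA => [|[_]]; last by rewrite ltNge Cle.
  by apply; split=> //; apply: (le_lt_trans Cle); rewrite ltry.
(* Otherwise [y] would be a limit of points of the range, hence in it by closedness. *)
have [d d0 dle] : exists2 d, 0 < d & forall u, M u -> d <= rnorm (y - u).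
  apply: contrapT => nd; apply: My.
  have [|x xA xE] := @bounded_below_range_closed _ _ A l eps y Alin Acl e0 lb;
    last by exists x.
  move=> e e1; apply: contrapT => nx'; apply: nd; exists e => // _ [x xA <-].
  by rewrite leNgt; apply/negP => h; apply: nx'; exists x.
(* [K] bounds [normc z * rnorm u] for [u = (A - l) B v]. Tolerance [eta / (K + 1)] in Riesz' lemma
   then keeps the error strictly below [eta]. *)
pose K := normc z * (1 + normc (l - s) * N).
have K0 : 0 <= K by rewrite mulr_ge0// addr_ge0// mulr_ge0// normc_ge0.
have K1 : 0 < K + 1 by rewrite ltr_wpDl.
have Slin := subop_linear l Alin.
have M0 : M 0.
  by exists 0; [exact: (proj1 Alin)|exact: (linop0 Slin)].
have Mlin a u v : M u -> M v -> M (a *: u + v).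
  move=> [x1 x1A <-] [x2 x2A <-].
  by have [xA xE] := (proj2 Slin) a _ _ x1A x2A; exists (a *: x1 + x2).
have [v v1 vM] := almost_orthogonal dot_norm M0 Mlin d0 dle (divr_gt0 eta0 K1).
exists v => //.
have [BvA BvE] := BK v I.
pose u := A (B v) - l *: B v.
have uE : u = v - (l - s) *: B v.
  by rewrite -[X in _ = X - _]BvE /u scalerBl opprB addrA subrK.
have BvE' : B v = z *: (v - u).
  by rewrite uE opprB addrC subrK scalerA zls scale1r.
have -> : z - dot (B v) v = z * dot u v.
  by rewrite BvE' dotZl dotBl dot_unit//; ring.
have uM : M u by exists (B v).
rewrite normcM.
have un : rnorm u <= 1 + normc (l - s) * N.
  rewrite uE; apply: (le_trans (rnormD _ _)); rewrite rnormN v1 lerD2l rnormZ.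
  rewrite ler_wpM2l ?normc_ge0//; have := Nle v I; rewrite v1 mulr1; exact.
apply: (@le_lt_trans _ _ (K * (eta / (K + 1)))).
  rewrite /K -mulrA ler_wpM2l// [leRHS]mulrC.
  by apply: (le_trans (vM _ uM)); rewrite ler_wpM2l// divr_ge0 ?ltW.
apply: (@lt_le_trans _ _ eta).
  by rewrite mulrA ltr_pdivrMr// mulrC ltr_pM2l// ltrDl.
by rewrite lerDr divr_ge0 ?(ltW Ne0)// mulr_ge0 ?sqr_ge0 ?(ltW e0).
Qed.

(** A projected unit vector [p] has to be renormalised before it can test a numerical range. Its
    norm [r] lies in [[1/2, 3/2]], so [r ^- 2 <= 4] and [|r ^+ 2 - 1| <= 5/2 * rnorm (p - x)]. The
    constants are [14 = 4 * (5/2 + 1)] and [6 = 4 * 3/2]. *)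
Lemma dot_normalized_perturbation (x p b0 b : H) (K : R) :
  rnorm x = 1 -> rnorm b0 <= K -> rnorm (p - x) <= 1 / 2 ->
  normc (dot b0 x - dot ((rnorm p)^-1%:C *: b) ((rnorm p)^-1%:C *: p))
    <= 14 * K * rnorm (p - x) + 6 * rnorm (b - b0).
Proof.
move=> x1 b0K; set be := rnorm (p - x); set al := rnorm (b - b0) => be2.
set r := rnorm p.
have r_le : r <= 1 + be.
  by have := rnormD (p - x) x; rewrite subrK x1 -/be -/r; lra.
have r_ge : 1 - be <= r.
  by have := rnormD p (x - p); rewrite addrC subrK x1 rnorm_distC -/be -/r; lra.
have be0 : 0 <= be by exact: rnorm_ge0.
have al0 : 0 <= al by exact: rnorm_ge0.
have b00 := rnorm_ge0 b0.
have r0 : 0 < r by lra.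
have rn0 : r != 0 by rewrite gt_eqF.
have rC0 : r%:C != 0 by rewrite -[0]/(0%:C) (inj_eq (@complexI R)).
rewrite dotZl dotZr [Num.conj _]conj_Creal; last first.
  by rewrite realE ler0c invr_ge0 (ltW r0).
have -> : dot b0 x - r^-1%:C * (r^-1%:C * dot b p)
    = (r ^- 2)%:C * ((r ^+ 2 - 1)%:C * dot b0 x - (dot (b - b0) p + dot b0 (p - x))).
  rewrite dotBl linearBr/= rmorphB !fmorphV !rmorphXn/= rmorph1; field.
  by rewrite rC0.
rewrite normcM normc_real; last by rewrite invr_ge0 exprn_ge0// ltW.
have w1 : normc (dot b0 x) <= K.
  by apply: (le_trans (dot_le dot_norm _ _)); rewrite x1 mulr1.
have w2 : normc (dot (b - b0) p) <= al * (1 + be).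
  by apply: (le_trans (dot_le dot_norm _ _)); rewrite ler_wpM2l.
have w3 : normc (dot b0 (p - x)) <= K * be.
  by apply: (le_trans (dot_le dot_norm _ _)); rewrite ler_wpM2r.
have w4 : normc ((r ^+ 2 - 1)%:C * dot b0 x) <= (5 / 2 * be) * K.
  rewrite normcM ler_pM ?normc_ge0//.
  rewrite /= expr0n/= addr0 sqrtr_sqr ler_norml; apply/andP; split; nra.
rewrite mulrC ler_pdivrMr ?exprn_gt0//.
apply: (le_trans (le_normcD _ _)); rewrite normcN.
have w5 := le_normcD (dot (b - b0) p) (dot b0 (p - x)).
have r2 : 1 / 4 <= r ^+ 2 by nra.
have : al * (1 + be) <= al * (3 / 2) by rewrite ler_wpM2l//; lra.
have : (14 * K * be + 6 * al) * (1 / 4) <= (14 * K * be + 6 * al) * r ^+ 2.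
  by rewrite ler_wpM2l// addr_ge0 ?mulr_ge0//; apply: le_trans b0K.
have : 0 <= K * be by rewrite mulr_ge0//; apply: le_trans b0K.
nra.
Qed.

(** * Strong convergence of the shifted resolvents and of their numerical ranges *)

Lemma subop0 (T : operator H) : subop T 0 = T.
Proof.
by case: T => D f; congr Operator; apply/funext => x; rewrite scale0r subr0.
Qed.

(** Strong convergence is given at the point 0 only. A resolvent identity carries it to [s], and the
    uniform bound on the resolvents of [An n] at [s] makes the error term vanish. *)
Lemma resolvent_strong_cvg (A : operator H) (U : nat -> set H)
    (P : nat -> {linear H -> H}) (An : nat -> operator H) (s : R[i]) :
  linear_operator A -> resolvent_set setT A 0 ->
  approximates_strongly U P An A ->
  resolvent_set setT A s -> (forall n, resolvent_set (U n) (An n) s) ->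
  (ereal_sup (range (fun n => opnorm (invop (subop (An n) s)))) < +oo)%E ->
  forall x, (fun n => rnorm (invop (subop (An n) s) (P n x)
                             - invop (subop A s) x)) @ \oo --> (0 : R).
Proof.
move=> Alin A0 [_ Pproj Pcvg Anend Ancvg] sA sAn supfin x.
have [_ BK _ _] := resolventP Alin sA.
have [bij0 _] := A0; rewrite subop0 in bij0.
have [_ AK KA] := invopP bij0.
have [yA yE] := BK x I.
set y := invop (subop A s) x in yA yE *.
(* The convergence at 0 is used at this vector, because [A^-1 u = y]. *)
pose u := A y.
have uy : invop A u = y by exact: KA.
have Anlin n : linear_operator (An n) by have [[]] := Anend n.
have PU n w : U n (P n w) by have [_ _ <-] := Pproj n; exists w.
pose yn n := invop (An n) (P n u).
pose Bn n := invop (subop (An n) s).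
have [C [C0 CB]] : exists C : R, 0 <= C /\
    forall n w, U n w -> rnorm (Bn n w) <= C * rnorm w.
  have fin n : exists N : R, [/\ opnorm (Bn n) = N%:E, 0 <= N &
        forall y, U n y -> rnorm (Bn n y) <= N * rnorm y].
    by have [_ _ _] := resolventP (Anlin n) (sAn n).
  set S := ereal_sup _ in supfin.
  have Sub n : (opnorm (Bn n) <= S)%E by apply: ereal_sup_ubound; exists n.
  have S0 : (0 <= S)%E.
    have [N [NE N0 _]] := fin 0%N; apply: le_trans (Sub 0%N).
    by rewrite NE lee_fin.
  exists (fine S); split; first exact: fine_ge0.
  move=> n w wU; have [N [NE N0 Nle]] := fin n.
  apply: (le_trans (Nle _ wU)); rewrite ler_wpM2r ?rnorm_ge0//.
  by rewrite -lee_fin fineK ?ge0_fin_numE// -NE.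
have ync : (fun n => rnorm (yn n - y)) @ \oo --> (0 : R).
  by apply: cvg_rnorm_dist; rewrite -uy; exact: Ancvg.
have Pyc : (fun n => rnorm (P n y - y)) @ \oo --> (0 : R).
  by apply: cvg_rnorm_dist; exact: Pcvg.
pose g n := rnorm (yn n - y) +
  normc s * (C * (rnorm (yn n - y) + rnorm (P n y - y))).
have gc : g @ \oo --> (0 : R).
  rewrite [X in _ --> X](_ : 0 = 0 + normc s * (C * (0 + 0))); last first.
    by rewrite addr0 mulr0 mulr0 addr0.
  by apply: cvgD => //; apply: cvgM; [exact: cvg_cst|];
    apply: cvgM; [exact: cvg_cst|]; exact: cvgD.
apply: (@squeeze_cvgr _ _ _ _ (fun=> 0) g) => //; last exact: cvg_cst.
apply: nearW => n; rewrite rnorm_ge0 andTb.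
have [_ Anbij] := Anend n.
have [[_ Ad _ _] _] := Anend n.
have bijn : set_bij (dom (An n)) (U n) (An n) by rewrite Ad.
have [_ AnK _] := invopP bijn.
have [ynU ynE] := AnK _ (PU n u).
have [[Bnlin Bnd] _ KBn _] := resolventP (Anlin n) (sAn n).
have [vU vE] := KBn _ ynU.
rewrite -/(yn n) in vU vE ynE ynU.
(* [(A_n - s)^-1 P_n x = y_n + s (A_n - s)^-1 (y_n - P_n y)], where
   [y_n = A_n^-1 P_n A y] and [P_n y] both converge to [y = (A - s)^-1 x]. *)
have ypU : U n (yn n - P n y).
  have PyD : dom (An n) (P n y) by rewrite Ad; exact: PU.
  by have [] := linopB (Anlin n) ynU PyD; rewrite Ad.
have PxE : P n x = s *: (yn n - P n y) + (An n (yn n) - s *: yn n).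
  by rewrite ynE -yE linearB linearZ/= -/u scalerBr [RHS]addrC addrA subrK.
rewrite -/(Bn n); have -> : Bn n (P n x) = s *: Bn n (yn n - P n y) + yn n.
  have [] := (proj2 Bnlin) s (yn n - P n y) (An n (yn n) - s *: yn n).
  - by rewrite Bnd.
  - by rewrite Bnd.
  - by move=> _; rewrite PxE vE.
rewrite -addrA addrC; apply: (le_trans (rnormD _ _)); rewrite lerD2l rnormZ.
rewrite ler_wpM2l ?normc_ge0//; apply: (le_trans (CB _ _ ypU)).
rewrite ler_wpM2l//.
have := rnormD (yn n - y) (y - P n y).
by rewrite addrA subrK [rnorm (y - _)]rnorm_distC.
Qed.

Lemma numerical_range_approx (A : operator H) (U : nat -> set H)
    (P : nat -> {linear H -> H}) (An : nat -> operator H) (s : R[i]) :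
  linear_operator A -> resolvent_set setT A 0 ->
  approximates_strongly U P An A ->
  resolvent_set setT A s -> (forall n, resolvent_set (U n) (An n) s) ->
  (ereal_sup (range (fun n => opnorm (invop (subop (An n) s)))) < +oo)%E ->
  forall w e, numerical_range dot (invop (subop A s)) w -> 0 < e ->
  \forall n \near \oo, exists2 v,
    numerical_range dot (invop (subop (An n) s)) v & normc (w - v) < e.
Proof.
move=> Alin A0 Aapp sA sAn supfin _ e [x [_ x1] <-] e0.
have Bc := resolvent_strong_cvg Alin A0 Aapp sA sAn supfin x.
have [_ Pproj Pcvg Anend _] := Aapp.
have PU n w : U n (P n w) by have [_ _ <-] := Pproj n; exists w.
have Anlin n : linear_operator (An n) by have [[]] := Anend n.
have Pc : (fun n => rnorm (P n x - x)) @ \oo --> (0 : R).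
  by apply: cvg_rnorm_dist; exact: Pcvg.
set b0 := invop (subop A s) x in Bc *.
pose K := rnorm b0.
have K0 : 0 <= K by exact: rnorm_ge0.
have h c : 0 < c -> \forall n \near \oo, rnorm (P n x - x) < c.
  move=> c0; have /cvgr0Pnorm_lt/(_ _ c0) := Pc.
  by apply: filterS => n; rewrite ger0_norm ?rnorm_ge0.
(* The bound [14 * K * be + 6 * al] is split evenly: [al < e / 12] makes the second term less than
   [e / 2], and [be < e / (28 * (K + 1))] does so for the first, also when [K = 0]. *)
have e12 : 0 < e / 12 by rewrite divr_gt0.
have k1 : 0 < 28 * (K + 1) by lra.
near=> n.
have Pn : rnorm (P n x - x) < 1 / 2 by near: n; apply: h; lra.
have Pn2 : rnorm (P n x - x) < e / (28 * (K + 1)).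
  by near: n; apply: h; rewrite divr_gt0.
have Bn : rnorm (invop (subop (An n) s) (P n x) - b0) < e / 12.
  near: n; have /cvgr0Pnorm_lt/(_ _ e12) := Bc.
  by apply: filterS => n; rewrite ger0_norm ?rnorm_ge0.
pose r := rnorm (P n x).
have [[Bnlin Bnd] _ _ _] := resolventP (Anlin n) (sAn n).
have pD : dom (invop (subop (An n) s)) (P n x) by rewrite Bnd; exact: PU.
have p0 : P n x != 0.
  by apply/eqP => p0; move: Pn; rewrite p0 sub0r rnormN x1; lra.
have [vD vE] := linopZ r^-1%:C Bnlin pD.
exists (dot (r^-1%:C *: invop (subop (An n) s) (P n x)) (r^-1%:C *: P n x)).
  by exists (r^-1%:C *: P n x); [split; [|exact: rnorm_normalized]|rewrite vE].
apply: (le_lt_trans (dot_normalized_perturbation _ x1 (lexx _) (ltW Pn))).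
rewrite -/K; set be := rnorm (P n x - x) in Pn2 *.
have be0 : 0 <= be by exact: rnorm_ge0.
have : be * (28 * (K + 1)) < e by rewrite -ltr_pdivlMr.
set al := rnorm _ in Bn *; nra.
Unshelve. all: by end_near. Qed.

Lemma numerical_range_bounded (A : operator H) (s : R[i]) (w : R[i]) :
  linear_operator A -> resolvent_set setT A s ->
  numerical_range dot (invop (subop A s)) w ->
  normc w <= fine (opnorm (invop (subop A s))).
Proof.
move=> Alin sA [x [_ x1] <-].
have [_ _ _ [N [-> _ Nle]]] := resolventP Alin sA.
apply: (le_trans (dot_le dot_norm _ _)); rewrite x1 mulr1.
by have := Nle x I; rewrite x1 mulr1.
Qed.

End NumericalRange.

(** * From pointwise to uniform approximation on bounded plane sets *)

Section UniformApproximation.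
Context {R : realType}.

Lemma truncn_eq_dist (x y h : R) : 0 < h -> 0 <= x -> 0 <= y ->
  Num.truncn (x / h) = Num.truncn (y / h) -> `|x - y| < h.
Proof.
move=> h0 x0 y0 xy.
have /truncn_itv/andP[x1 x2] : 0 <= x / h by rewrite divr_ge0// ltW.
have /truncn_itv/andP[] : 0 <= y / h by rewrite divr_ge0// ltW.
rewrite -xy; move: x1 x2.
rewrite !ler_pdivlMr// !ltr_pdivrMr// -natr1 mulrDl mul1r.
by set t := _%:R * h => *; rewrite ltr_norml; apply/andP; split; lra.
Qed.

(* A bounded subset of the plane meets finitely many cells of a square grid,
   and one point per cell controls the whole cell. *)
Lemma bounded_near_uniform (S : set R[i]) (V : nat -> set R[i]) (C e : R) :
  (forall w, S w -> normc w <= C) -> 0 < e ->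
  (forall w r, S w -> 0 < r ->
    \forall n \near \oo, exists2 v, V n v & normc (w - v) < r) ->
  \forall n \near \oo, forall w, S w -> exists2 v, V n v & normc (w - v) < e.
Proof.
(* With side [e / 4], the real and imaginary parts contribute at most [e / 2] within a cell, leaving
   [e / 2] for approximating the representative. *)
move=> SC e0 SV; pose h := e / 4.
have h0 : 0 < h by rewrite divr_gt0.
pose K := Num.truncn (2 * C / h).
(* Adding [C] makes the coordinates nonnegative, where [Num.truncn] is the integer part; they are
   then at most [2 * C], whence [K]. *)
pose coord (a : R) := Num.truncn ((a + C) / h).
have coordK a : `|a| <= C -> 0 <= a + C /\ (coord a < K.+1)%N.
  rewrite ler_norml => /andP[a1 a2]; split; first by lra.
  by rewrite ltnS le_truncn// ler_pM2r ?invr_gt0//; lra.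
pose cell (w : R[i]) : 'I_K.+1 * 'I_K.+1 :=
  (inord (coord (complex.Re w)), inord (coord (complex.Im w))).
have cell_dist w w' : S w -> S w' -> cell w = cell w' -> normc (w - w') <= e / 2.
  move=> Sw Sw' [re im].
  have bnd z : S z -> `|complex.Re z| <= C /\ `|complex.Im z| <= C.
    move=> /SC zC; split; apply: le_trans zC;
      [exact: Re_le_normc|exact: Im_le_normc].
  have [/coordK[r1 r2] /coordK[i1 i2]] := bnd _ Sw.
  have [/coordK[r1' r2'] /coordK[i1' i2']] := bnd _ Sw'.
  move: re im => /(congr1 val) + /(congr1 val); rewrite /= !inordK//.
  move=> /(truncn_eq_dist h0 r1 r1') re /(truncn_eq_dist h0 i1 i1') im.
  apply: (le_trans (normc_le_ReIm _)); rewrite !raddfB/=.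
  have -> : complex.Re w - complex.Re w'
      = complex.Re w + C - (complex.Re w' + C) by ring.
  have -> : complex.Im w - complex.Im w'
      = complex.Im w + C - (complex.Im w' + C) by ring.
  by move: re im; rewrite /h; lra.
suff : \forall n \near \oo, forall p, forall w, S w -> cell w = p ->
    exists2 v, V n v & normc (w - v) < e.
  by apply: filterS => n nP w Sw; exact: nP Sw erefl.
(* The cells form a finite type, so finitely many eventual statements can be intersected. *)
apply: filter_forall => p.
have [[w0 [Sw0 w0p]]|np] := pselect (exists w, S w /\ cell w = p); last first.
  by apply: nearW => n w Sw wp; exfalso; apply: np; exists w.
have := SV _ _ Sw0 (divr_gt0 e0 (ltr0Sn _ 1)).
apply: filterS => n [v Vv vlt] w Sw wp; exists v => //.
have := cell_dist _ _ Sw Sw0 (etrans wp (esym w0p)).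
have := le_normcD (w - w0) (w0 - v); rewrite addrA subrK.
by move: vlt; lra.
Qed.

Lemma thickening_lt (U : set R[i]) (d : R) (z u : R[i]) :
  U u -> normc (z - u) < d -> thickening d U z.
Proof.
move=> Uu zu; rewrite /thickening /cdist /=.
apply: (@le_lt_trans _ _ (normc (z - u))%:E); last by rewrite lte_fin.
by apply: ereal_inf_lbound; exists u.
Qed.

End UniformApproximation.

(** * The pseudospectral enclosure *)

Theorem theorem3p6 (R : realType) (H : completeNormedModType R[i])
    (dot : {dot H for Num.conj})
    (dot_norm : forall x : H, dot x x = `|x| ^+ 2)
    (A : operator H)
    (A_linear : linear_operator A)
    (A_closed : closed_operator A)
    (A_dense : dense (dom A))
    (A_inv : resolvent_set setT A 0)
    (U : nat -> set H) (P : nat -> {linear H -> H}) (An : nat -> operator H)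
    (A_approx : approximates_strongly U P An A)
    (m : nat) (m_gt0 : (0 < m)%N) (s : 'I_m -> R[i])
    (s_res : forall j, resolvent_set setT A (s j))
    (sn_res : forall j n, resolvent_set (U n) (An n) (s j))
    (sn_bounded : forall j,
      (ereal_sup (range (fun n => opnorm (invop (subop (An n) (s j))))) < +oo)%E)
    (eps : R) (eps_gt0 : 0 < eps)
    (eps_lt : (eps%:E
      < (\big[maxe/0]_(j < m) opnorm (invop (subop A (s j))))^-1)%E)
    (delta : 'I_m -> R)
    (delta_gt : forall j, let N := opnorm (invop (subop A (s j))) in
      (N ^+ 2 * eps%:E / (1 - N * eps%:E) < (delta j)%:E)%E) :
  exists n0 : nat, forall n : nat, (n0 <= n)%N ->
    pseudospectrum setT A eps `<=`
    \bigcap_(j in [set: 'I_m])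
      shift_set
        (inv_set (thickening (delta j)
           (numerical_range dot (invop (subop (An n) (s j))))))
        (s j).
Proof.
suff [n0 _ n0P] : \forall n \near \oo, forall j : 'I_m,
    pseudospectrum setT A eps `<=`
      shift_set (inv_set (thickening (delta j)
        (numerical_range dot (invop (subop (An n) (s j)))))) (s j).
  by exists n0 => n /n0P nP l lA j _; exact: nP.
apply: filter_forall => j.
have [_ _ _ [N [NE N0 _]]] := resolventP A_linear (s_res j).
have Ne1 : N * eps < 1.
  have : (N%:E <= \big[maxe/0]_(j < m) opnorm (invop (subop A (s j))))%E.
    by rewrite -NE; exact: le_bigmax_cond.
  set B := (\big[maxe/0]_(_ < m) _)%E in eps_lt * => NB.
  (* The case [N = 0] is separate because the extended inverse of 0 is infinite and cannot be read
     as a real bound on [eps]. *)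
  have [->|Nn0] := eqVneq N 0; first by rewrite mul0r.
  have Np : 0 < N by rewrite lt_def Nn0.
  have BN : (B^-1 <= N%:E^-1)%E.
    by rewrite lee_pV2// inE ?lee_fin//; apply: le_trans NB; rewrite lee_fin.
  have := lt_le_trans eps_lt BN.
  by rewrite inver (negbTE Nn0) lte_fin -[N^-1]mul1r ltr_pdivlMr// mulrC.
have Ne0 : 0 < 1 - N * eps by rewrite subr_gt0.
pose d0 := N ^+ 2 * eps / (1 - N * eps).
have d0lt : d0 < delta j.
  have : (N%:E ^+ 2 * eps%:E / (1 - N%:E * eps%:E) < (delta j)%:E)%E.
    by rewrite -NE; exact: delta_gt.
  by rewrite -EFin_expe -!EFinM -EFinB inver gt_eqF//.
(* Half of the slack goes to the distance from [(l - s j)^-1] to the numerical range of the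
   resolvent of [A], half to approximating that range at level [n]. *)
pose eta := (delta j - d0) / 2.
have eta0 : 0 < eta by rewrite divr_gt0// subr_gt0.
have := bounded_near_uniform
  (fun w => numerical_range_bounded dot_norm A_linear (s_res j)) eta0
  (numerical_range_approx dot_norm A_linear A_inv A_approx
     (s_res j) (sn_res j) (sn_bounded j)).
apply: filterS => n nP l lA.
have [ls [x x1 xlt]] := pseudospectrum_near_numerical_range dot_norm A_linear
  A_closed (s_res j) NE eps_gt0 Ne1 lA eta0.
have [|v Wv vlt] := nP (dot (invop (subop A (s j)) x) x).
  exists x => //; split=> //.
  by have [[_ ->] _ _ _] := resolventP A_linear (s_res j).
(* Membership unwinds to [(l - s j)^-1] being a nonzero point of the thickening; it is nonzero
   because [l != s j]. *)
exists (l - s j); last by rewrite subrK.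
exists (l - s j)^-1; last by rewrite invrK.
split; last by apply/eqP; rewrite invr_eq0 subr_eq0.
apply: (thickening_lt Wv).
have := le_normcD ((l - s j)^-1 - dot (invop (subop A (s j)) x) x)
                  (dot (invop (subop A (s j)) x) x - v).
rewrite addrA subrK => h; apply: (le_lt_trans h).
by move: xlt vlt; rewrite -/d0 /eta; lra.
Qed.
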